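(* Let $\mathbb{F}_{q_0}$ be a finite field of characteristic $p\geq 5$, and let $L(t_1)\in\mathbb{F}_{q_0}[t_1]$ and $M(t_2)\in\mathbb{F}_{q_0}[t_2]$ be arbitrary polynomials in one variable. For each finite extension $\mathbb{F}_q/\mathbb{F}_{q_0}$, let $E_{\mathbb{F}_q}\subset\mathbb{F}_q^3$ be the image of the map $$\mathbb{F}_q^3\to\mathbb{F}_q^3,\qquad (s,t_1,t_2)\mapsto (s,\ st_1+L(t_1),\ st_2+M(t_2)).$$ Then $$|E_{\mathbb{F}_q}|\geq \frac{q^3}{4}-O(q^{5/2}),$$ where the implied constant depends only on the degrees of $L$ and $M$.
   Context: The notation $|E_{\mathbb{F}_q}|\geq \frac{q^3}{4}-O(q^{5/2})$ with implied constant depending only on the degrees of $L$ and $M$ means: there is a constant $A\ge 0$, depending only on $\deg L$ and $\deg M$ (in particular not on $q$), such that $|E_{\mathbb{F}_q}|\geq \frac{q^3}{4}-A q^{5/2}$ for every finite extension $\mathbb{F}_q/\mathbb{F}_{q_0}$. *)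

(* Defs.v *)
From HB Require Import structures.
From mathcomp Require Import all_boot all_order all_algebra.

Set Implicit Arguments.
Unset Strict Implicit.
Unset Printing Implicit Defensive.

Local Open Scope ring_scope.

(* A finite extension F / F0 of finite fields is given by its structure map
   iota : F0 -> F. *)
Definition param_map (F0 F : finFieldType) (iota : {rmorphism F0 -> F})
    (L M : {poly F0}) (x : F * F * F) : F * F * F :=
  let: (s, t1, t2) := x in
  (s, s * t1 + (map_poly iota L).[t1], s * t2 + (map_poly iota M).[t2]).

Definition image_set3 (F0 F : finFieldType) (iota : {rmorphism F0 -> F})
    (L M : {poly F0}) : {set F * F * F} :=
  [set param_map iota L M x | x : F * F * F].

(* Main.v *)
Require Import Defs.
From mathcomp Require Import all_boot all_order all_algebra.
From mathcomp Require Import reals exp.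
From mathcomp Require Import ring lra.

(** Write q for the order of F. The slice of the image over a fixed s is the
    product of the images of the two maps t |-> s t + L(t) and
    t |-> s t + M(t), so it is enough to bound the product of their sizes from
    below, on average over s.

    For a map f on F, let N(f) be the number of pairs (t, t') with f t = f t'.
    Cauchy-Schwarz on the fibres of f gives q^2 <= |f(F)| N(f)
    ([sqr_card_le_image_collisions]). On the other hand two distinct points
    t, t' collide under t |-> s t + h(t) for exactly one s, the slope of -h
    between them, so the numbers N sum over s to 2 q^2 - q, whatever h is
    ([sum_collisions_le]): on average N is just below 2 q. Were N equal to 2 q
    for every s and both maps, each of the two images would have size at least
    q/2 and the image in F^3 at least q (q/2)^2 = q^3/4 points. That an average
    suffices is the convexity of 1/(x y), used through its tangent plane
    3 - x - y at (1, 1) ([mul_ge_tangent]).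

    The lower bound q^3/4 obtained this way holds with no error term, so the
    constant A can be taken to be 0. *)

Set Implicit Arguments.
Unset Strict Implicit.
Unset Printing Implicit Defensive.

Import Order.TTheory GRing.Theory Num.Theory.

Local Open Scope ring_scope.

Definition collisions (T U : finType) (f : T -> U) : nat :=
  #|[set x : T * T | f x.1 == f x.2]|.

Lemma collisions_sum (T U : finType) (f : T -> U) :
  collisions f = (\sum_t \sum_(t' : T) (f t == f t'))%N.
Proof.
rewrite pair_big /= /collisions -sum1_card big_mkcond /=.
by apply: eq_bigr => x _; rewrite inE; case: (_ == _).
Qed.

Lemma card_fibres (T U : finType) (f : T -> U) :
  (\sum_(u in f @: [set: T]) #|[set t | f t == u]|)%N = #|T|.
Proof.
rewrite -cardsT -sum1_card (partition_big_imset f) /=.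
apply: eq_bigr => u _; rewrite -sum1_card; apply: eq_bigl => t.
by rewrite !inE.
Qed.

Lemma collisions_fibres (T U : finType) (f : T -> U) :
  collisions f = (\sum_(u in f @: [set: T]) #|[set t | f t == u]| ^ 2)%N.
Proof.
have fibE t : (\sum_(t' : T) (f t == f t') = #|[set t' | f t' == f t]|)%N.
  rewrite -sum1_card big_mkcond [RHS]big_mkcond /=.
  by apply: eq_bigr => t' _; rewrite inE eq_sym; case: (_ == _).
rewrite collisions_sum (eq_bigr _ (fun t _ => fibE t)).
rewrite -(eq_bigl _ _ (in_setT (T := T))) (partition_big_imset f) /=.
apply: eq_bigr => u _.
rewrite (eq_bigr (fun=> #|[set t | f t == u]|)); last first.
  by move=> t /andP[_ /eqP ->].
rewrite sum_nat_const expnS expn1; congr (_ * _)%N.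
by apply: eq_card => t; rewrite unfold_in !inE.
Qed.

(** Cauchy-Schwarz for the fibre sizes c_u, in the optimised form
    sum over the image of (n c_u - N)^2 >= 0, where n is the size of the
    source and N the number of collisions. *)
Lemma sqr_card_le_image_collisions (R : realFieldType) (T U : finType)
    (f : T -> U) :
  (#|T|%:R : R) ^+ 2 <= #|f @: [set: T]|%:R * (collisions f)%:R.
Proof.
set n : R := #|T|%:R; set N : R := (collisions f)%:R.
pose c u : R := #|[set t | f t == u]|%:R.
have sc : \sum_(u in f @: [set: T]) c u = n by rewrite -natr_sum card_fibres.
have sc2 : \sum_(u in f @: [set: T]) c u ^+ 2 = N.
  rewrite /N collisions_fibres natr_sum.
  by apply: eq_bigr => u _; rewrite natrX.
have : 0 <= \sum_(u in f @: [set: T]) (n * c u - N) ^+ 2.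
  by apply: sumr_ge0 => u _; exact: sqr_ge0.
rewrite (eq_bigr (fun u => n ^+ 2 * c u ^+ 2 - 2 * n * N * c u + N ^+ 2));
  last by move=> u _; ring.
rewrite big_split /= sumrB -!mulr_sumr sc sc2 sumr_const -mulr_natl.
set m := #|_|%:R => ineq.
have [N0|N0] := eqVneq N 0.
  (* Without collisions, not even on the diagonal, the source is empty. *)
  suff -> : n = 0 by rewrite N0 expr0n mulr0.
  rewrite -sc big1 // => u uf; apply/eqP; rewrite -sqrf_eq0.
  have := N0; rewrite -sc2 => /eqP.
  rewrite psumr_eq0; last by move=> v _; exact: sqr_ge0.
  by move=> /allP/(_ u (mem_index_enum u)); rewrite uf.
have Np : 0 < N by rewrite lt_def N0 ler0n.
rewrite -subr_ge0 -(pmulr_rge0 _ Np).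
by apply: le_trans ineq _; rewrite le_eqVlt; apply/orP; left; apply/eqP; ring.
Qed.

Lemma collisions_gt0 (T U : finType) (f : T -> U) :
  (0 < #|T|)%N -> (0 < collisions f)%N.
Proof.
by case/card_gt0P => t _; apply/card_gt0P; exists (t, t); rewrite inE /=.
Qed.

(** The diagonal pairs collide for every s, and each of the remaining pairs
    for only one s, since the equation in s is linear and non-constant. *)
Lemma sum_collisions_le (F : finFieldType) (h : F -> F) :
  (\sum_(s : F) collisions (fun t => (s * t + h t)%R) <= 2 * #|F| ^ 2)%N.
Proof.
rewrite (eq_bigr _ (fun s _ => collisions_sum _)) exchange_big /=.
under eq_bigr => t _ do rewrite exchange_big /=.
have off_diag t t' : t' != t ->
    (\sum_(s : F) (s * t + h t == s * t' + h t')%R <= 1)%N.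
  move=> neq; have dn0 : t - t' != 0 by rewrite subr_eq0 eq_sym.
  rewrite (bigD1 ((h t' - h t) / (t - t'))) //= big1 ?addn0 ?leq_b1 //.
  move=> s; apply: contraNeq; rewrite eqb0 negbK => /eqP e.
  rewrite -(inj_eq (mulIf dn0)) divfK // mulrBr subr_eq addrAC eq_sym subr_eq.
  by rewrite e addrC.
apply: (@leq_trans (\sum_(t : F) (#|F| + #|F|))%N); last first.
  by rewrite sum_nat_const addnn -mul2n mulnCA expnS expn1.
apply: leq_sum => t _; rewrite (bigD1 t) //=; apply: leq_add.
  by rewrite -sum1_card; apply: leq_sum => s _; exact: leq_b1.
apply: (@leq_trans (\sum_(t' | t' != t) 1)%N); first exact: leq_sum (off_diag t).
by rewrite sum1_card max_card.
Qed.

(** When a = 1/x and b = 1/y this says that 1/(x y) lies above its tangent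
    plane at (1, 1), which is the inequality between the arithmetic and
    geometric means of x, y and 1/(x y). *)
Lemma mul_ge_tangent (R : realFieldType) (a b x y : R) :
  0 < x -> 0 < y -> 1 <= a * x -> 1 <= b * y -> 3 - x - y <= a * b.
Proof.
move=> x0 y0 ax byy.
have amgm : 0 <= y * x ^+ 2 + (y ^+ 2 - 3 * y) * x + 1.
  have [y4|y4] := leP y 4.
    (* As a quadratic in x it has discriminant y (y - 1)^2 (y - 4) <= 0. *)
    have y40 : 0 < 4 * y by lra.
    rewrite -(pmulr_rge0 _ y40).
    have -> : 4 * y * (y * x ^+ 2 + (y ^+ 2 - 3 * y) * x + 1) =
      (2 * y * x + y ^+ 2 - 3 * y) ^+ 2 + y * (y - 1) ^+ 2 * (4 - y) by ring.
    apply: addr_ge0; first exact: sqr_ge0.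
    by apply: mulr_ge0; [exact: mulr_ge0 (ltW y0) (sqr_ge0 _) | lra].
  have -> : y ^+ 2 - 3 * y = y * (y - 3) by ring.
  have y3 : 0 <= y - 3 by lra.
  apply: addr_ge0 ler01; apply: addr_ge0.
    exact: mulr_ge0 (ltW y0) (sqr_ge0 x).
  exact: mulr_ge0 (mulr_ge0 (ltW y0) y3) (ltW x0).
have xy0 : 0 < x * y by exact: mulr_gt0.
rewrite -subr_ge0 -(pmulr_lge0 _ xy0).
have abxy : 1 <= (a * x) * (b * y).
  by rewrite -[1]mulr1 ler_pM.
have -> : (a * b - (3 - x - y)) * (x * y) =
  ((a * x) * (b * y) - 1) + (y * x ^+ 2 + (y ^+ 2 - 3 * y) * x + 1) by ring.
by rewrite addr_ge0 // subr_ge0.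
Qed.

Lemma card_slices (S T U V : finType) (f : S -> T -> U) (g : S -> T -> V) :
  #|[set (x.1.1, f x.1.1 x.1.2, g x.1.1 x.2) | x : S * T * T]| =
  (\sum_s #|f s @: [set: T]| * #|g s @: [set: T]|)%N.
Proof.
set E := [set _ | _ in _].
rewrite -sum1_card (partition_big (fun y => y.1.1) xpredT) //=.
apply: eq_bigr => s _; rewrite sum1_card -cardsX.
rewrite -[RHS](@card_imset _ _ (fun w : U * V => (s, w.1, w.2))); last first.
  by move=> [u v] [u' v'] [-> ->].
apply: eq_card => -[[s' u] v]; rewrite unfold_in /=; apply/andP/imsetP.
- case=> /imsetP[[[s0 t1] t2] _ [-> -> ->]] /eqP <-.
  by exists (f s0 t1, g s0 t2); rewrite // in_setX !imset_f ?inE.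
- case=> -[u' v']; rewrite in_setX => /andP[/imsetP[t1 _ /= ->]].
  move=> /imsetP[t2 _ /= ->] [-> -> ->]; split=> //.
  by apply/imsetP; exists (s, t1, t2).
Qed.

(** The tangent-plane bound is applied to each slice, with x and y the two
    collision counts in units of their typical value 2 q, and a and b the image
    sizes in units of q/2. It is linear in x and y, so that summing it over s
    only involves the total numbers of collisions. *)
Lemma card_image_ge (R : realFieldType) (F : finFieldType) (h k : F -> F) :
  (#|F|%:R : R) ^+ 3 / 4 <=
  #|[set (x.1.1, x.1.1 * x.1.2 + h x.1.2, x.1.1 * x.2 + k x.2)
      | x : F * F * F]|%:R.
Proof.
rewrite (card_slices (fun s t => s * t + h t) (fun s t => s * t + k t)).
have cF : (0 < #|F|)%N by apply/card_gt0P; exists 0.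
set q : R := #|F|%:R; have q0 : 0 < q by rewrite ltr0n.
have q2 : 0 < 2 * q by rewrite mulr_gt0.
pose N (h : F -> F) (s : F) : R := (collisions (fun t => s * t + h t))%:R.
pose I (h : F -> F) (s : F) : R := #|(fun t => s * t + h t) @: [set: F]|%:R.
have N0 h' s : 0 < N h' s / (2 * q).
  by rewrite divr_gt0 // ltr0n collisions_gt0.
have IN h' s : 1 <= (I h' s / (q / 2)) * (N h' s / (2 * q)).
  have -> : (I h' s / (q / 2)) * (N h' s / (2 * q)) = I h' s * N h' s / q ^+ 2.
    by field; rewrite gt_eqF.
  rewrite ler_pdivlMr ?exprn_gt0 // mul1r.
  exact: sqr_card_le_image_collisions.
have sumN h' : \sum_s N h' s <= 2 * q ^+ 2.
  by rewrite -natr_sum -natrX -natrM ler_nat sum_collisions_le.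
have slice s : q ^+ 2 / 4 * 3 - q / 8 * (N h s + N k s) <= I h s * I k s.
  have := mul_ge_tangent (N0 h s) (N0 k s) (IN h s) (IN k s).
  have q24 : 0 < q ^+ 2 / 4 by rewrite divr_gt0 ?exprn_gt0.
  rewrite -(ler_pM2l q24).
  congr (_ <= _); field; rewrite ?gt_eqF //.
rewrite natr_sum; under eq_bigr => s _ do rewrite natrM.
apply: le_trans (ler_sum _ (fun s _ => slice s)).
rewrite sumrB sumr_const -mulr_sumr big_split /= -mulr_natr -/q.
have sumhk : q / 8 * (\sum_s N h s + \sum_s N k s) <= q / 8 * (4 * q ^+ 2).
  apply: ler_wpM2l; first by rewrite divr_ge0 // ltW.
  by have := sumN h; have := sumN k; lra.
apply: le_trans (lerB (lexx _) sumhk).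
by rewrite le_eqVlt; apply/orP; left; apply/eqP; field.
Qed.

Theorem proposition2 (R : realType) (dL dM : nat) :
  exists2 A : R, 0 <= A &
    forall (F0 : finFieldType) (p : nat) (L M : {poly F0}),
      p \in [pchar F0] -> (5 <= p)%N ->
      size L = dL -> size M = dM ->
      forall (F : finFieldType) (iota : {rmorphism F0 -> F}),
        #|F|%:R ^+ 3 / 4 - A * #|F|%:R `^ (5 / 2)
          <= #|image_set3 iota L M|%:R :> R.
Proof.
exists 0 => // F0 p L M _ _ _ _ F iota; rewrite mul0r subr0.
apply: le_trans (card_image_ge R (horner (map_poly iota L))
                                 (horner (map_poly iota M))) _.
rewrite ler_nat subset_leq_card //; apply/subsetP => y /imsetP[[[s t1] t2] _ ->].
by apply/imsetP; exists (s, t1, t2).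
Qed.
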